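(* Let $H\le G$ be a subgroup such that $\omega|_{H\times H\times H}$ is trivial in $H^3(H,k^\times)$, and let $\mu\in C^2(G,C)$ satisfy $\delta^2\mu=\omega$. Then the dual category $\mathcal C^*_{\mathcal M}$, where $\mathcal C=\mathcal V(G,\omega)$ and $\mathcal M=\mathcal M(H,\mu)$, is pointed if and only if: (1) $H$ is abelian, (2) $H$ is normal in $G$, and (3) the restriction $\psi({}^y\mu/\mu)$ is trivial in $H^2(H,k^\times)$ for all $y\in K$. If $\omega\equiv1$, $\mu\in Z^2(H,k^\times)$ and the module structure on $\mathcal M$ is given by $\varphi(\mu)$, then condition (3) may be replaced by: (3$'$) $\mu$ represents a $G$-invariant class in $H^2(H,k^\times)$.
   Context: $k$ algebraically closed of characteristic $0$. $G$ finite, $\omega\in Z^3(G,k^\times)$ normalized; $\mathcal C=\mathcal V(G,\omega)$ is the skeletal fusion category with simple objects $g\in G$, $g_1\otimes g_2=g_1g_2$, associator $\omega(g_1,g_2,g_3)$ (equivalent to $\mathrm{Vec}(G,\omega)$). $K=H\backslash G$, $p(g)=Hg$, $1:=p(1_G)$, $u\colon K\to G$ a section of $p$ with $u(1)=1_G$, $x\triangleleft g=p(u(x)g)$, $\kappa_{x,g}\in H$ with $u(x)g=\kappa_{x,g}u(x\triangleleft g)$. $C=\mathrm{Fun}(K,k^\times)$, left $G$-module $(g\triangleright f)(x)=f(x\triangleleft g)$; cochains normalized with standard multiplicative coboundary $(\delta f)(g_1,\dots,g_{n+1})=(g_1\triangleright f(g_2,\dots))\prod_i f(\dots,g_ig_{i+1},\dots)^{(-1)^i}f(g_1,\dots,g_n)^{(-1)^{n+1}}$;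 in $\delta^2\mu=\omega$, $\omega$ is viewed as $C$-valued constant functions. $\mathcal M(H,\mu)$: semisimple right $\mathcal C$-module category with simple objects $K$, $x\otimes g=x\triangleleft g$, associativity $\mu(g_1,g_2)(x)$, trivial unit constraint. $\mathcal C^*_{\mathcal M}$: $\mathcal C$-module endofunctors of $\mathcal M$ with natural module transformations, tensor product composition. Pointed: every simple object is invertible. For $y\in K^H$ ($H$-fixed points; equal to $K$ when $H$ is normal): $({}^y\gamma)(g_1,\dots,g_n)(x)=\gamma(g_1,\dots,g_n)(p(u(y)u(x)))$. $\psi(\gamma)(h_1,h_2)=\gamma(h_1,h_2)(1)$. For $\mu\in Z^2(H,k^\times)$: $\varphi(\mu)(g_1,g_2)(x)=\mu(\kappa_{x,g_1},\kappa_{x\triangleleft g_1,g_2})$. $G$ acts on $H^2(H,k^\times)$ (for $H$ normal) via $\mu^g(h_1,h_2)=\mu(gh_1g^{-1},gh_2g^{-1})$. *)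

(* Defs.v *)
From HB Require Import structures.
From mathcomp Require Import all_boot all_order all_fingroup all_algebra.
Set Implicit Arguments. Unset Strict Implicit. Unset Printing Implicit Defensive.
Import GRing.Theory.
Local Open Scope ring_scope.

Section Defs.
Variables (gT : finGroupType) (H : {group gT}).

Definition cosetT := {X : {set gT} | X \in rcosets H [set: gT]}.

Lemma pc_proof (g : gT) : rcoset H g \in rcosets H [set: gT].
Proof. by apply/imsetP; exists g; rewrite ?inE. Qed.

Definition pc (g : gT) : cosetT := exist _ (rcoset H g) (pc_proof g).

Record section := Sect {
  sec :> cosetT -> gT;
  sec_pc : forall x, pc (sec x) = x;
  sec_1 : sec (pc 1%g) = 1%g }.

Variable k : fieldType.

Definition Z3_normalized (omega : gT -> gT -> gT -> k) : Prop :=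
  [/\ forall g1 g2 g3, omega g1 g2 g3 != 0,
      forall g1 g2, omega 1%g g1 g2 = 1 /\ omega g1 1%g g2 = 1 /\ omega g1 g2 1%g = 1 &
      forall g1 g2 g3 g4,
        omega g2 g3 g4 * omega g1 (g2 * g3)%g g4 * omega g1 g2 g3
        = omega (g1 * g2)%g g3 g4 * omega g1 g2 (g3 * g4)%g].

Definition restr_trivial (omega : gT -> gT -> gT -> k) : Prop :=
  exists beta : gT -> gT -> k,
    [/\ forall h1 h2, h1 \in H -> h2 \in H -> beta h1 h2 != 0,
        forall h, h \in H -> beta 1%g h = 1 /\ beta h 1%g = 1 &
        forall h1 h2 h3, h1 \in H -> h2 \in H -> h3 \in H ->
          omega h1 h2 h3 = beta h2 h3 * beta h1 (h2 * h3)%g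
                           / (beta (h1 * h2)%g h3 * beta h1 h2)].

(* a 2-cochain gamma : H x H -> k^x (given as a function on G x G, only its
   values on H x H matter) is trivial in H^2(H,k^x), i.e. is a coboundary of
   a normalized 1-cochain *)
Definition H2_trivial (gamma : gT -> gT -> k) : Prop :=
  exists alpha : gT -> k,
    [/\ forall h, h \in H -> alpha h != 0, alpha 1%g = 1 &
        forall h1 h2, h1 \in H -> h2 \in H ->
          gamma h1 h2 = alpha h1 * alpha h2 / alpha (h1 * h2)%g].

Definition Z2_H (mu : gT -> gT -> k) : Prop :=
  [/\ forall h1 h2, h1 \in H -> h2 \in H -> mu h1 h2 != 0,
      forall h, h \in H -> mu 1%g h = 1 /\ mu h 1%g = 1 &
      forall h1 h2 h3, h1 \in H -> h2 \in H -> h3 \in H ->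
        mu h2 h3 * mu h1 (h2 * h3)%g = mu (h1 * h2)%g h3 * mu h1 h2].

Definition G_invariant (mu : gT -> gT -> k) : Prop :=
  forall g : gT, H2_trivial (fun h1 h2 =>
    mu (g * h1 * g^-1)%g (g * h2 * g^-1)%g / mu h1 h2).

Definition psi (gamma : gT -> gT -> cosetT -> k) : gT -> gT -> k :=
  fun h1 h2 => gamma h1 h2 (pc 1%g).

(* normalized C-valued 2-cochain mu in C^2(G, C), C = Fun(K, k^x) *)
Definition C2_normalized (mu : gT -> gT -> cosetT -> k) : Prop :=
  (forall g1 g2 x, mu g1 g2 x != 0) /\
  (forall g x, mu 1%g g x = 1 /\ mu g 1%g x = 1).

Section WithSection.
Variable u : section.

Definition act (x : cosetT) (g : gT) : cosetT := pc (u x * g)%g.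

(* kappa_{x,g} in H with u(x) g = kappa_{x,g} u(x <| g) *)
Definition kappa (x : cosetT) (g : gT) : gT := (u x * g * (u (act x g))^-1)%g.

(* (delta mu)(g1,g2,g3)(x), the standard coboundary with left G-action
   (g |> f)(x) = f(x <| g) *)
Definition dC2 (mu : gT -> gT -> cosetT -> k) (g1 g2 g3 : gT) (x : cosetT) : k :=
  mu g2 g3 (act x g1) * mu g1 (g2 * g3)%g x / (mu (g1 * g2)%g g3 x * mu g1 g2 x).

Definition yconj (y : cosetT) (gamma : gT -> gT -> cosetT -> k) :
  gT -> gT -> cosetT -> k :=
  fun g1 g2 x => gamma g1 g2 (pc (u y * u x)%g).

Definition phi (mu : gT -> gT -> k) : gT -> gT -> cosetT -> k :=
  fun g1 g2 x => mu (kappa x g1) (kappa (act x g1) g2).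

(* The dual category C^*_M for M = M(H, mu), realised concretely.       *)
(* A C-module endofunctor F of the semisimple category M is given by    *)
(* F(x) = (+)_z V_{x,z} z; we present the spaces V_{x,z} via a finite  *)
(* basis B graded by (src, tgt) : B -> K x K.  The module constraint    *)
(* s_{x,g} : F(x <| g) -> F(x) (x) g is a family of linear maps          *)
(* V_{x<|g, z<|g} -> V_{x,z}, recorded as a B x B matrix S g acting on   *)
(* row vectors (entry S g i j, i in the source block, j in the target). *)

Record mfun := MFun {
  mfB : finType;
  msrc : mfB -> cosetT;
  mtgt : mfB -> cosetT;
  mS : gT -> mfB -> mfB -> k }.

Arguments mS : clear implicits.
Arguments msrc : clear implicits.
Arguments mtgt : clear implicits.
Definition mmul (A B C : finType) (X : A -> B -> k) (Y : B -> C -> k) : A -> C -> k :=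
  fun i j => \sum_(m : B) X i m * Y m j.

Definition midm (A : finType) : A -> A -> k := fun i j => (i == j)%:R.

Variable mu : gT -> gT -> cosetT -> k.

(* F is a C-module functor M(H,mu) -> M(H,mu):
   - s_{x,g} is a morphism F(x<|g) -> F(x) (x) g (grading),
   - s_{x,1} = id (trivial unit constraints),
   - each s_{x,g} is an isomorphism,
   - module functor coherence with the associativity constraint mu:
     m_{F(x),g1,g2} o (s_{x,g1} (x) id) o s_{x<|g1,g2} = s_{x,g1 g2} o F(m_{x,g1,g2}). *)
Definition is_modfun (F : mfun) : Prop :=
  [/\ forall g i j, mS F g i j != 0 ->
        msrc F i = act (msrc F j) g /\ mtgt F i = act (mtgt F j) g,
      forall i j, mS F 1%g i j = midm i j,
      forall g, exists T : mfB F -> mfB F -> k,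
        (forall i j, mmul (mS F g) T i j = midm i j) /\
        (forall i j, mmul T (mS F g) i j = midm i j) &
      forall g1 g2 i j,
        mmul (mS F g2) (mS F g1) i j * mu g1 g2 (mtgt F j)
        = mS F (g1 * g2)%g i j * mu g1 g2 (msrc F j)].

Definition is_hom (F F' : mfun) (T : mfB F -> mfB F' -> k) : Prop :=
  (forall i j, T i j != 0 -> msrc F i = msrc F' j /\ mtgt F i = mtgt F' j) /\
  (forall g i j, mmul (mS F g) T i j = mmul T (mS F' g) i j).

Definition is_iso (F F' : mfun) (T : mfB F -> mfB F' -> k) : Prop :=
  is_hom T /\ exists T' : mfB F' -> mfB F -> k,
    [/\ is_hom T', forall i j, mmul T T' i j = midm i j &
        forall i j, mmul T' T i j = midm i j].

Definition isomorphic (F F' : mfun) : Prop := exists T, @is_iso F F' T.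

Definition is_mono (F' F : mfun) (T : mfB F' -> mfB F -> k) : Prop :=
  forall (F'' : mfun) (A B : mfB F'' -> mfB F' -> k),
    is_modfun F'' -> is_hom A -> is_hom B ->
    (forall i j, mmul A T i j = mmul B T i j) -> forall i j, A i j = B i j.

Definition is_zero (F : mfun) : Prop := #|mfB F| = 0%N.

Definition simple (F : mfun) : Prop :=
  [/\ is_modfun F, ~ is_zero F &
      forall (F' : mfun) (T : mfB F' -> mfB F -> k),
        is_modfun F' -> is_hom T -> is_mono T -> is_zero F' \/ is_iso T].

(* tensor product in C^*_M: composition; comp F F' = F' o F, with
   (F' o F)(x) = (+)_{y,z} V_{x,y} (x) V'_{y,z} z and module constraint
   s^{F'}_{F(x),g} o F'(s^F_{x,g}) *)
Definition comp (F F' : mfun) : mfun :=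
  @MFun {p : mfB F * mfB F' | mtgt F p.1 == msrc F' p.2}
    (fun p => msrc F (val p).1) (fun p => mtgt F' (val p).2)
    (fun g p q => mS F g (val p).1 (val q).1 * mS F' g (val p).2 (val q).2).

Definition unitF : mfun :=
  @MFun cosetT id id (fun g i j => (i == act j g)%:R).

Definition invertible (F : mfun) : Prop :=
  exists F' : mfun, [/\ is_modfun F', isomorphic (comp F F') unitF &
                         isomorphic (comp F' F) unitF].

Definition pointed : Prop := forall F : mfun, simple F -> invertible F.

End WithSection.
End Defs.

(* Main.v *)
(** A module endofunctor of M(H, mu) is a representation of the action groupoid
    of G on K x K, twisted by the 2-cocycle mu(x) / mu(z). It is invertible when
    its matrix of dimensions is a permutation matrix. The simple ones supported
    on the orbit of (1, y) correspond to the irreducible twisted representations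
    of the stabiliser of y in H, so all of them are invertible exactly when H
    fixes y and these representations are one-dimensional. As y varies, the
    first condition says that H is normal; a one-dimensional twisted
    representation trivialises psi(^y mu / mu), and for y = 1 there is no twist,
    so that every irreducible representation of H is linear and H is abelian.
    Conversely, if the twist is trivial and H is abelian, the component of degree
    (1, y) of a simple functor contains a common eigenvector of H, which
    generates an invertible subfunctor. *)
From HB Require Import structures.
From mathcomp Require Import all_boot all_order all_fingroup all_algebra.
From mathcomp Require Import all_solvable all_character.
From mathcomp Require Import ring.
From Stdlib Require Import Classical FunctionalExtensionality.
Require Import Defs.
Set Implicit Arguments. Unset Strict Implicit. Unset Printing Implicit Defensive.
Import GRing.Theory.
Local Open Scope ring_scope.

(** * Finite types and characteristic zero *)

Lemma funext2 (A B C : Type) (f g : A -> B -> C) :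
  (forall i j, f i j = g i j) -> f = g.
Proof.
move=> fg; apply: functional_extensionality => i.
exact: functional_extensionality.
Qed.

Lemma card1_bij (A B : finType) (f : A -> B) :
  (forall y, #|[pred i | f i == y]| = 1%N) <-> bijective f.
Proof.
split=> [f1 | bijf y]; last first.
  case: (bijf) => g fK gK; rewrite -(card1 (g y)); apply: eq_card => i.
  by rewrite !inE (can2_eq fK gK).
have ex y : {i | f i == y}.
  have : (0 < #|[pred i | f i == y]|)%N by rewrite f1.
  by move/card_gt0P=> exi; apply/sigW; case: exi => i; exists i.
exists (fun y => sval (ex y)) => [i|y]; last by case: (ex y) => i /= /eqP.
case: (ex (f i)) => j /= eqf.
have /card_le1_eqP le1 : (#|[pred i' | f i' == f i]| <= 1)%N by rewrite f1.
by apply: le1; rewrite !inE.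
Qed.

Lemma pchar0_natr_inj (k : fieldType) : [pchar k] =i pred0 -> injective (fun n => n%:R : k).
Proof.
move=> /pcharf0P char0 m n /= eq_mn; wlog le_mn: m n eq_mn / (m <= n)%N.
  by case/orP: (leq_total m n) => le_mn IH; [apply: IH | apply/esym/IH].
apply/eqP; rewrite eqn_leq le_mn -subn_eq0 -char0 natrB // eq_mn.
by rewrite subrr eqxx.
Qed.

(** * Linear algebra over arbitrary finite index types *)

Section LinearAlgebra.
Variable k : fieldType.

Definition vmul (A B : finType) (v : A -> k) (T : A -> B -> k) : B -> k :=
  fun j => \sum_i v i * T i j.

(** Vectors are rows and matrices act on their right; injectivity of this action is the concrete
    form of a monomorphism. *)
Definition injmx (A B : finType) (T : A -> B -> k) : Prop :=
  forall v, (forall j, vmul v T j = 0) -> forall i, v i = 0.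

Lemma vmulA (A B C : finType) (v : A -> k) (X : A -> B -> k) (Y : B -> C -> k) :
  vmul (vmul v X) Y = vmul v (mmul X Y).
Proof.
apply: functional_extensionality => j; rewrite /vmul /mmul.
under eq_bigr do rewrite mulr_suml.
under [RHS]eq_bigr do rewrite mulr_sumr.
by rewrite exchange_big; do 2!apply: eq_bigr => ? _; rewrite mulrA.
Qed.

Lemma mmulA (A B C D : finType) (X : A -> B -> k) (Y : B -> C -> k)
    (Z : C -> D -> k) : mmul (mmul X Y) Z = mmul X (mmul Y Z).
Proof.
apply: functional_extensionality => i.
exact: (vmulA (X i) Y Z).
Qed.

Lemma vmul1 (A : finType) (v : A -> k) : vmul v (@midm k A) = v.
Proof.
apply: functional_extensionality => j; rewrite /vmul (bigD1 j) //= /midm eqxx.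
by rewrite mulr1 big1 ?addr0 // => i /negPf->; rewrite mulr0.
Qed.

Lemma mmul1 (A B : finType) (X : A -> B -> k) : mmul X (@midm k B) = X.
Proof. by apply: functional_extensionality => i; apply: (vmul1 (X i)). Qed.

Lemma mul1m (A B : finType) (X : A -> B -> k) : mmul (@midm k A) X = X.
Proof.
apply: funext2 => i j.
rewrite /mmul (bigD1 i) //= /midm eqxx mul1r big1 ?addr0 // => m.
by rewrite eq_sym => /negPf->; rewrite mul0r.
Qed.

Lemma vmul_neq0 (A B : finType) (v : A -> k) (T : A -> B -> k) j :
  vmul v T j != 0 -> exists i, v i != 0 /\ T i j != 0.
Proof.
move=> nz; have [i /andP[] | no] := pickP (fun i => (v i != 0) && (T i j != 0)).
  by exists i.
case/eqP: nz; apply: big1 => i _; apply/eqP; rewrite mulf_eq0.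
by move: (no i); case: eqP; case: eqP.
Qed.

Lemma vmul_unique (A B : finType) (v : A -> k) (T : A -> B -> k) i0 j :
  (forall i, v i != 0 -> T i j != 0 -> i = i0) -> vmul v T j = v i0 * T i0 j.
Proof.
move=> Hi0; rewrite /vmul (bigD1 i0) //= big1 ?addr0 // => i ne_i.
apply/eqP; rewrite mulf_eq0; apply: contraNT ne_i; rewrite negb_or.
by case/andP=> ? ?; apply/eqP/Hi0.
Qed.

Lemma injmx_cancel (A B C : finType) (T : B -> C -> k) (X Y : A -> B -> k) :
  injmx T -> mmul X T = mmul Y T -> X = Y.
Proof.
move=> injT eqXY; apply: funext2 => i j; apply/eqP; rewrite -subr_eq0; apply/eqP.
apply: (injT (fun j => X i j - Y i j)) => m; rewrite /vmul.
under eq_bigr do rewrite mulrBl.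
by rewrite sumrB -/(mmul X T i m) eqXY subrr.
Qed.

Lemma injmx_comp (A B C : finType) (X : A -> B -> k) (Y : B -> C -> k) :
  injmx X -> injmx Y -> injmx (mmul X Y).
Proof.
by move=> injX injY v vXY; apply: injX; apply: injY => j; rewrite vmulA vXY.
Qed.

Lemma inv_injmx (A B : finType) (X : A -> B -> k) (Y : B -> A -> k) :
  mmul X Y = @midm k A -> injmx X.
Proof.
move=> XY v vX i; rewrite -[v]vmul1 -XY -vmulA /vmul.
by apply: big1 => j _; rewrite [\sum_i0 _]vX mul0r.
Qed.

Lemma reindex_enum_val (A : finType) (f : A -> k) :
  \sum_i f i = \sum_(i < #|A|) f (enum_val i).
Proof. by rewrite (reindex (@enum_val A A)) //; exact/onW_bij/enum_val_bij. Qed.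

(** Renumbering by ordinals gives access to the rank theory of matrices. *)
Definition mx_fun (A B : finType) (T : A -> B -> k) : 'M[k]_(#|A|, #|B|) :=
  \matrix_(i, j) T (enum_val i) (enum_val j).

Lemma injmx_row_free (A B : finType) (T : A -> B -> k) :
  injmx T -> row_free (mx_fun T).
Proof.
move=> injT; apply: inj_row_free => v vT.
have v0: forall i, v 0 (enum_rank i) = 0.
  apply: injT => j; rewrite /vmul reindex_enum_val.
  move/rowP/(_ (enum_rank j)): vT; rewrite !mxE.
  under eq_bigr do rewrite mxE enum_rankK.
  by under [X in _ -> X = _]eq_bigr do rewrite enum_valK.
by apply/rowP => i; rewrite -[i]enum_valK v0 mxE.
Qed.

Lemma injmx_card (A B : finType) (T : A -> B -> k) : injmx T -> (#|A| <= #|B|)%N.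
Proof. by move/injmx_row_free/eqnP=> <-; apply: rank_leq_col. Qed.

Lemma injmx_inv (A B : finType) (T : A -> B -> k) :
  injmx T -> #|A| = #|B| ->
  exists T', mmul T T' = @midm k A /\ mmul T' T = @midm k B.
Proof.
move=> injT eqAB; have freeT := injmx_row_free injT.
have [N TN] := row_freeP freeT.
have [N' NT] : exists N', N' *m mx_fun T = 1%:M.
  by apply/row_fullP; rewrite /row_full (eqnP freeT) eqAB.
have eqN: N' = N by rewrite -[LHS]mulmx1 -TN mulmxA NT mul1mx.
pose T' b a := N (enum_rank b) (enum_rank a).
exists T'; split; apply: funext2 => i j; rewrite /midm /mmul reindex_enum_val.
  move/matrixP/(_ (enum_rank i) (enum_rank j)): TN.
  rewrite !mxE (inj_eq enum_rank_inj) => <-; apply: eq_bigr => m _.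
  by rewrite mxE enum_rankK /T' enum_valK.
move/matrixP/(_ (enum_rank i) (enum_rank j)): NT.
rewrite eqN !mxE (inj_eq enum_rank_inj) => <-; apply: eq_bigr => m _.
by rewrite mxE enum_rankK /T' enum_valK.
Qed.

Lemma inv_intertwine (A B : finType) (T : A -> B -> k) T'
    (X : A -> A -> k) (Y : B -> B -> k) :
  mmul T T' = @midm k A -> mmul T' T = @midm k B ->
  mmul X T = mmul T Y -> mmul T' X = mmul Y T'.
Proof.
move=> TT' T'T XT.
rewrite -[X in mmul T' X]mmul1 -TT' -!mmulA [mmul (mmul T' X) T]mmulA XT.
by rewrite -mmulA T'T mul1m.
Qed.

End LinearAlgebra.

(** * The right action of G on cosets, and [kappa] *)

Section Cosets.
Variables (gT : finGroupType) (H : {group gT}) (u : section H).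
Local Notation K := (cosetT H).
Implicit Types (x y z : K) (g h a : gT).

(** Since x is the coset of u(x), the section disappears on underlying sets, and the action laws
    become those of right translation. *)
Lemma val_act x g : val (act u x g) = (val x :* g)%g.
Proof. by rewrite -{2}[x](sec_pc u) /= !rcosetE rcosetM. Qed.

Lemma actM x g h : act u (act u x g) h = act u x (g * h)%g.
Proof. by apply: val_inj; rewrite !val_act rcosetM. Qed.

Lemma act1 x : act u x 1%g = x.
Proof. by apply: val_inj; rewrite val_act mulg1. Qed.

Lemma actK x g : act u (act u x g) g^-1 = x.
Proof. by rewrite actM mulgV act1. Qed.

Lemma actKV x g : act u (act u x g^-1) g = x.
Proof. by rewrite actM mulVg act1. Qed.

Lemma act_inj g x y : act u x g = act u y g -> x = y.
Proof. by move=> e; rewrite -[x](actK _ g) e actK. Qed.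

Lemma act_pc g h : act u (pc H g) h = pc H (g * h)%g.
Proof. by apply: val_inj; rewrite val_act /= !rcosetE rcosetM. Qed.

Lemma act_sec x : act u (pc H 1) (u x) = x.
Proof. by rewrite act_pc mul1g sec_pc. Qed.

Lemma act_secV x : act u x (u x)^-1%g = pc H 1.
Proof. by rewrite -{1}[x]act_sec actK. Qed.

Lemma eq_pc g h : (pc H g == pc H h) = (g * h^-1 \in H)%g.
Proof.
by rewrite -val_eqE /= !rcosetE (sameP eqP rcoset_eqP) mem_rcoset.
Qed.

Lemma act_pc1 g : (act u (pc H 1) g == pc H 1) = (g \in H).
Proof. by rewrite act_pc eq_pc mul1g invg1 mulg1. Qed.

Lemma act1_H h : h \in H -> act u (pc H 1) h = pc H 1.
Proof. by rewrite -act_pc1 => /eqP. Qed.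

Lemma kappa_in x g : kappa u x g \in H.
Proof. by rewrite /kappa -eq_pc sec_pc. Qed.

Lemma kappaM x g h :
  kappa u x (g * h)%g = (kappa u x g * kappa u (act u x g) h)%g.
Proof. by rewrite /kappa actM -!mulgA mulKg. Qed.

Lemma kappa1 x : kappa u x 1 = 1%g.
Proof. by rewrite /kappa act1 mulg1 mulgV. Qed.

Lemma kappa_pc1 h : h \in H -> kappa u (pc H 1) h = h.
Proof. by move=> Hh; rewrite /kappa act1_H // sec_1 mul1g invg1 mulg1. Qed.

Lemma act_normal x h : (H <| [set: gT])%g -> h \in H -> act u x h = x.
Proof.
move=> /andP[_ nH] Hh; rewrite -{2}[x](sec_pc u); apply/eqP; rewrite eq_pc.
have -> : (u x * h * (u x)^-1 = h ^ (u x)^-1)%g by rewrite conjgE invgK mulgA.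
by rewrite memJ_norm // (subsetP nH) ?inE.
Qed.
End Cosets.

(** * Module functors as twisted graded representations *)

Lemma div_cocycle (k : fieldType) (a b c d a' b' c' d' : k) :
  a' != 0 -> b' != 0 -> c != 0 -> d != 0 -> c' != 0 -> d' != 0 ->
  a * b / (c * d) = a' * b' / (c' * d') -> a / a' * (b / b') = c / c' * (d / d').
Proof.
move=> Ha' Hb' Hc Hd Hc' Hd' /eqP; rewrite eqr_div ?mulf_neq0 // => /eqP E.
have -> : a / a' * (b / b') = a * b * (c' * d') / (a' * b' * (c' * d')).
  by field; rewrite Ha' Hb' Hc' Hd'.
by rewrite E; field; rewrite Ha' Hb' Hc' Hd'.
Qed.

Section ModuleFunctors.
Variables (k : closedFieldType) (gT : finGroupType) (H : {group gT}) (u : section H).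
Variables (omega : gT -> gT -> gT -> k) (mu : gT -> gT -> cosetT H -> k).
Hypothesis mu_norm : C2_normalized mu.
Hypothesis d_mu : forall g1 g2 g3 x, dC2 u mu g1 g2 g3 x = omega g1 g2 g3.
Local Notation K := (cosetT H).
Local Notation mfun := (Defs.mfun H k).
Local Notation is_modfun := (is_modfun u mu).
Local Notation act := (act u).
Implicit Types (x y z : K) (g h a : gT) (F : mfun).

Lemma mu_neq0 g h x : mu g h x != 0.
Proof. by case: mu_norm => + _; apply. Qed.

Lemma mu1g g x : mu 1%g g x = 1.
Proof. by case: mu_norm => _ /(_ g x)[]. Qed.

Lemma mug1 g x : mu g 1%g x = 1.
Proof. by case: mu_norm => _ /(_ g x)[]. Qed.

(** The multiplier by which the constraints of a module functor fail to compose in degree (x, z). *)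
Definition lam g h x z : k := mu g h x / mu g h z.

Lemma lam_neq0 g h x z : lam g h x z != 0.
Proof. by rewrite mulf_neq0 ?invr_eq0 ?mu_neq0. Qed.

Lemma lamg1 g x z : lam g 1%g x z = 1.
Proof. by rewrite /lam !mug1 divr1. Qed.

Lemma lamxx g h x : lam g h x x = 1.
Proof. by rewrite /lam divff ?mu_neq0. Qed.

(* The 3-cocycle omega cancels in the quotient of the values of mu at two cosets. *)
Lemma lam_cocycle g1 g2 g3 x z :
  lam g2 g3 (act x g1) (act z g1) * lam g1 (g2 * g3)%g x z =
  lam (g1 * g2)%g g3 x z * lam g1 g2 x z.
Proof.
apply: div_cocycle; rewrite ?mu_neq0 //.
by rewrite -/(dC2 u mu g1 g2 g3 x) -/(dC2 u mu g1 g2 g3 z) !d_mu.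
Qed.

Definition graded F := forall g (i j : mfB F), mS g i j != 0 ->
  msrc i = act (msrc j) g /\ mtgt i = act (mtgt j) g.
Definition coherent F := forall g1 g2 (i j : mfB F),
  mmul (mS g2) (mS g1) i j = lam g1 g2 (msrc j) (mtgt j) * mS (g1 * g2)%g i j.

(* The coherence at (g, g^-1) makes mS g^-1 inverse to mS g up to scaling. *)
Lemma modfunP F : is_modfun F <->
  [/\ graded F, mS 1%g = @midm k (mfB F) & coherent F].
Proof.
split=> [[gr S1 _ coh]|[gr S1 coh]]; split=> //.
- by apply: funext2 => i j; apply: S1.
- move=> g1 g2 i j; apply: (mulIf (mu_neq0 g1 g2 (mtgt j))).
  by rewrite coh /lam mulrAC divfK ?mu_neq0 // mulrC.
- by move=> i j; rewrite S1.
- move=> g.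
  (* [T1] rescales by the row degree and [T2] by the column degree; as a left and a right inverse
     they agree. *)
  pose T1 := fun i j : mfB F => (lam g g^-1 (msrc i) (mtgt i))^-1 * mS g^-1 i j.
  pose T2 := fun i j : mfB F => mS g^-1 i j / lam g^-1 g (msrc j) (mtgt j).
  have ST2 : mmul (mS g) T2 = @midm k (mfB F).
    apply: funext2 => i j; rewrite /mmul /T2.
    under eq_bigr do rewrite mulrA.
    rewrite -mulr_suml -/(mmul _ _ _ _) [X in X / _]coh mulVg S1 mulrC mulKf //.
    exact: lam_neq0.
  have T1S : mmul T1 (mS g) = @midm k (mfB F).
    apply: funext2 => i j; rewrite /mmul /T1.
    under eq_bigr do rewrite -mulrA.
    rewrite -mulr_sumr [X in _ * X]coh mulgV S1 /midm.
    by case: eqP => [->|_]; rewrite ?mulr0 // mulr1 mulVf // lam_neq0.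
  exists T1; split; last by rewrite T1S.
  suff -> : T1 = T2 by rewrite ST2.
  by rewrite -[T1]mmul1 -ST2 -mmulA T1S mul1m.
- move=> g1 g2 i j; rewrite coh /lam mulrAC divfK ?mu_neq0 //.
  by rewrite mulrC.
Qed.

Definition homog F x z (v : mfB F -> k) :=
  forall j, v j != 0 -> msrc j = x /\ mtgt j = z.

(** The constraint runs from the component at x <| g to the one at x, so [mS g] moves degrees
    backwards. *)
Lemma homog_act F x z g v : graded F ->
  homog (act x g) (act z g) v -> @homog F x z (vmul v (mS g)).
Proof.
move=> gr hv j /vmul_neq0[i [/hv[sx tz] /gr[sE tE]]].
by split; apply: (@act_inj _ _ u g); rewrite -?sE -?tE.
Qed.

Lemma homP F F' (T : mfB F -> mfB F' -> k) :
  is_hom T <-> (forall i, homog (msrc i) (mtgt i) (T i)) /\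
               (forall g, mmul (mS g) T = mmul T (mS g)).
Proof.
split=> [[gr eqT]|[gr eqT]]; split.
- by move=> i j /gr[].
- by move=> g; apply: funext2 => i j; apply: eqT.
- by move=> i j /gr[].
- by move=> g i j; rewrite eqT.
Qed.

Lemma hom_comp F F' F'' (T : mfB F -> mfB F' -> k) (T' : mfB F' -> mfB F'' -> k) :
  is_hom T -> is_hom T' -> is_hom (mmul T T').
Proof.
move=> /homP[gr eqT] /homP[gr' eqT']; apply/homP; split=> [i j|g].
  by case/vmul_neq0=> m [/gr[<- <-] /gr'].
by rewrite -mmulA eqT mmulA eqT' mmulA.
Qed.

(** Scalars depending on the degree, in matrix form. Commuting with them expresses preservation of
    degrees; with p = [lam g h] they carry the multiplier of [coherent]. *)
Definition diagm F (p : K -> K -> k) (i j : mfB F) : k :=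
  midm k i j * p (msrc j) (mtgt j).

Lemma mmul_diagr F p (A : finType) (Z : A -> mfB F -> k) i j :
  mmul Z (diagm p) i j = Z i j * p (msrc j) (mtgt j).
Proof.
rewrite -[Z in RHS]mmul1 /mmul mulr_suml; apply: eq_bigr => m _.
by rewrite mulrA.
Qed.

Lemma mmul_diagl F p (A : finType) (Z : mfB F -> A -> k) i j :
  mmul (diagm p) Z i j = p (msrc i) (mtgt i) * Z i j.
Proof.
rewrite -{2}[Z]mul1m /mmul mulr_sumr; apply: eq_bigr => m _.
by rewrite /diagm /midm; case: eqP => [->|_]; rewrite ?mul1r ?mul0r ?mulr0.
Qed.

(** Preserving degrees amounts to commuting with the projections onto them, so it passes to the
    inverse just as compatibility with [mS] does. *)
Lemma hom_inv F F' (T : mfB F -> mfB F' -> k) T' : is_hom T ->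
  mmul T T' = @midm k _ -> mmul T' T = @midm k _ -> is_hom T'.
Proof.
move=> /homP[gr eqT] TT' T'T; apply/homP; split=> [i j nz|g]; last first.
  exact/esym/(inv_intertwine TT' T'T).
pose p x z : k := ((x, z) == (msrc i, mtgt i))%:R.
have : mmul T' (diagm p) = mmul (diagm p) T'.
  apply: (inv_intertwine TT' T'T).
  apply: funext2 => m n.
  rewrite mmul_diagl mmul_diagr mulrC.
  by have [->|/gr[-> ->] //] := eqVneq (T m n) 0; rewrite !mul0r.
move/(congr1 (fun Z => Z i j)); rewrite mmul_diagr mmul_diagl /p eqxx mul1r.
by case: eqP => [[-> ->] //|_]; rewrite mulr0 => T'0; rewrite -T'0 eqxx in nz.
Qed.

(** The scalar in [coherent] depends on the degree of the column; on a homogeneous vector only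
    columns of one degree contribute. *)
Lemma coherentV F v g1 g2 x z : coherent F ->
  homog (act x (g1 * g2)%g) (act z (g1 * g2)%g) v -> graded F ->
  forall j, vmul (vmul v (mS g2)) (@mS _ _ _ F g1) j =
            lam g1 g2 x z * vmul v (mS (g1 * g2)%g) j.
Proof.
move=> coh hv gr j; rewrite vmulA.
have -> : vmul v (mmul (mS g2) (mS g1)) j =
    lam g1 g2 (msrc j) (mtgt j) * vmul v (mS (g1 * g2)%g) j.
  by rewrite /vmul mulr_sumr; apply: eq_bigr => i _; rewrite coh mulrCA.
have [->|nz] := eqVneq (vmul v (mS (g1 * g2)%g) j) 0; first by rewrite !mulr0.
by have [-> ->] := homog_act gr hv nz.
Qed.

(** * Free functors, monomorphisms and simple subfunctors *)

(* The twisted regular representation: homomorphisms from [freeF x z] to F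
   correspond to vectors of F of degree (x, z). *)
Definition freeF x z : mfun :=
  @MFun _ H k gT (act x) (act z) (fun g b a => (b == a * g)%g%:R * lam a g x z).

Lemma freeF_modfun x z : is_modfun (freeF x z).
Proof.
apply/modfunP; split.
- move=> g b a /=; have [->|] := eqVneq b; first by rewrite !actM.
  by rewrite mul0r eqxx.
- apply: funext2 => b a.
  by rewrite /= mulg1 lamg1 mulr1.
- move=> g1 g2 b a; rewrite /mmul /= (bigD1 (a * g1)%g) //= eqxx mul1r.
  rewrite big1 ?addr0 => [|m /negPf->]; last by rewrite mul0r mulr0.
  by rewrite -mulrA -lam_cocycle mulgA; ring.
Qed.

(** The generator 1 goes to v. In [freeF x z], [mS a^-1] carries it to [lam a a^-1 x z] times the
    basis vector a, which forces the value at a. *)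
Definition free_hom F x z (v : mfB F -> k) : mfB (freeF x z) -> mfB F -> k :=
  fun a j => vmul v (mS a^-1%g) j / lam a a^-1%g x z.

Lemma free_hom1 F x z v : is_modfun F -> @free_hom F x z v 1%g = v.
Proof.
case/modfunP=> _ S1 _; apply: functional_extensionality => j.
by rewrite /free_hom invg1 S1 vmul1 lamg1 divr1.
Qed.

Lemma free_homP F x z v : is_modfun F -> homog x z v -> is_hom (@free_hom F x z v).
Proof.
case/modfunP=> gr _ coh hv.
have hv' a : homog (act (act x a) a^-1) (act (act z a) a^-1) v by rewrite !actK.
apply/homP; split=> [a j|g].
  by rewrite mulf_eq0 negb_or => /andP[/(homog_act gr (hv' a))].
apply: funext2 => b j.
have -> : mmul (mS g) (@free_hom F x z v) b j =
    lam (b * g^-1)%g g x z * @free_hom F x z v (b * g^-1)%g j.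
  rewrite /mmul (bigD1 (b * g^-1)%g) //= mulgKV eqxx mul1r big1 ?addr0 //.
  move=> m ne; case: eqP => [Eb|_]; last by rewrite !mul0r.
  by case/eqP: ne; rewrite Eb mulgK.
have -> : mmul (@free_hom F x z v) (mS g) b j =
    vmul (vmul v (mS b^-1%g)) (mS g) j / lam b b^-1%g x z.
  by rewrite /mmul /vmul mulr_suml; apply: eq_bigr => i _; rewrite mulrAC.
pose a := (b * g^-1)%g; have Eb : b = (a * g)%g by rewrite mulgKV.
have Ea : (g * b^-1 = a^-1)%g by rewrite invMg invgK.
rewrite -/a /free_hom (coherentV (x := act x a) (z := act z a) coh) ?Ea //.
(* The cocycle identity at (a, g, b^-1), where a g = b and g b^-1 = a^-1, compares the two
   normalisations. *)
have := lam_cocycle a g b^-1%g x z; rewrite Ea -Eb => E.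
rewrite mulrCA [RHS]mulrAC [RHS]mulrC; congr (_ * _); apply/eqP.
by rewrite eqr_div ?lam_neq0 // E mulrC.
Qed.

Lemma hom0 F F' : is_hom (fun (i : mfB F) (j : mfB F') => 0 : k).
Proof.
apply/homP; split=> [i j|g]; first by rewrite eqxx.
apply: funext2 => i j.
by rewrite /mmul !big1 // => m _; rewrite ?mulr0 ?mul0r.
Qed.

(** T preserves degrees, so a nonzero vector killed by T has a nonzero homogeneous component killed
    by T. The map from a free functor defined by that component and the zero map agree after T. *)
Lemma mono_injmx F F' (T : mfB F -> mfB F' -> k) :
  is_modfun F -> is_hom T -> is_mono u mu T -> injmx T.
Proof.
move=> modF /homP[gr eqT] monoT v vT i; apply/eqP/negPn/negP=> nz.
pose w (j : mfB F) : k := ((msrc j, mtgt j) == (msrc i, mtgt i))%:R * v j.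
have hw : homog (msrc i) (mtgt i) w.
  by move=> j; rewrite /w; case: ((msrc j, _) =P _) => [[-> ->] //|_]; rewrite mul0r eqxx.
have wT : vmul w T = fun _ => 0.
  apply: functional_extensionality => j.
  pose c : k := ((msrc j, mtgt j) == (msrc i, mtgt i))%:R.
  rewrite -(mulr0 c) -(vT j) /vmul mulr_sumr; apply: eq_bigr => m _.
  rewrite /w /c -!mulrA.
  by have [->|/gr[-> ->] //] := eqVneq (T m j) 0; rewrite !mulr0.
have homA := free_homP modF hw.
have := monoT _ _ _ (freeF_modfun _ _) homA (hom0 _ _).
move=> /(_ _ 1%g i)/=; rewrite free_hom1 // /w eqxx mul1r => v0.
case/eqP: nz; apply: v0 => a j.
have -> : mmul (@free_hom F (msrc i) (mtgt i) w) T a j =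
    vmul (vmul w (mS a^-1%g)) T j / lam a a^-1%g (msrc i) (mtgt i).
  by rewrite /mmul /vmul mulr_suml; apply: eq_bigr => m _; rewrite mulrAC.
rewrite vmulA eqT -vmulA wT /mmul /vmul big1 => [|m _]; last by rewrite mul0r.
by rewrite mul0r big1 // => m _; rewrite mul0r.
Qed.

Lemma injmx_mono F F' (T : mfB F -> mfB F' -> k) :
  injmx T -> is_mono u mu T.
Proof.
move=> injT F'' X Y _ _ _ eqXY.
suff -> : X = Y by [].
by apply: (injmx_cancel injT); apply: funext2.
Qed.

Lemma injmx_iso F F' (T : mfB F -> mfB F' -> k) :
  is_hom T -> injmx T -> #|mfB F| = #|mfB F'| -> is_iso T.
Proof.
move=> homT injT /(injmx_inv injT)[T' [TT' T'T]]; split=> //; exists T'.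
by split; [apply: hom_inv TT' T'T | rewrite TT' | rewrite T'T].
Qed.

Lemma isoP F F' (T : mfB F -> mfB F' -> k) : is_iso T ->
  is_hom T /\ exists T', [/\ is_hom T', mmul T T' = @midm k _ & mmul T' T = @midm k _].
Proof.
case=> homT [T' [homT' TT' T'T]]; split=> //; exists T'.
by split=> //; apply: funext2.
Qed.

(** Induction on the size of the basis: a monomorphism that is not an isomorphism is injective,
    hence starts from a strictly smaller basis. *)
Lemma exists_simple_sub F : is_modfun F -> ~ is_zero F ->
  exists F0 (T : mfB F0 -> mfB F -> k),
    [/\ simple u mu F0, is_hom T & injmx T].
Proof.
have [n] := ubnP #|mfB F|; elim: n F => // n IHn F leF modF nzF.
have [simF|] := classic (simple u mu F).
  exists F, (@midm k _); split=> //; last first.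
    by apply: (@inv_injmx _ _ _ _ (@midm k _)); rewrite mmul1.
  apply/homP; split=> [i j|g]; last by rewrite mmul1 mul1m.
  by rewrite /midm; case: (i =P j) => [->|] //; rewrite eqxx.
move=> nsim; apply: NNPP => no; case: nsim; split=> // F' T modF' homT monoT.
have injT := mono_injmx modF' homT monoT.
apply: NNPP => nzT; case: no.
have [eqF|neF] := eqVneq #|mfB F'| #|mfB F|.
  by case: nzT; right; apply: injmx_iso.
have ltF : (#|mfB F'| < n)%N.
  by rewrite -ltnS (leq_trans _ leF) // ltnS ltn_neqAle neF (injmx_card injT).
have [|F0 [T0 [sim0 hom0 inj0]]] := IHn F' ltF modF'.
  by move=> z'; apply: nzT; left.
exists F0, (mmul T0 T); split=> //; first exact: hom_comp hom0 homT.
exact: injmx_comp.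
Qed.

(** * Invertibility and the matrix of dimensions *)

(* Both sides are the trace of the projection onto the degrees satisfying P. *)
Lemma iso_card_deg F F' (P : K -> K -> bool) : [pchar k] =i pred0 ->
  isomorphic F F' ->
  #|[pred i : mfB F | P (msrc i) (mtgt i)]| =
  #|[pred i : mfB F' | P (msrc i) (mtgt i)]|.
Proof.
move=> char0 [T /isoP[/homP[gr _] [T' [_ TT' T'T]]]].
apply: (pchar0_natr_inj char0); rewrite -!sum1_card !natr_sum.
have e (A : finType) (Q : pred A) : \sum_(i in Q) 1%:R = \sum_i (Q i)%:R :> k.
  by rewrite big_mkcond; apply: eq_bigr => i _; rewrite unfold_in; case: (Q i).
rewrite !e.
transitivity (\sum_(i : mfB F) \sum_(j : mfB F')
    (P (msrc j) (mtgt j))%:R * (T i j * T' j i)).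
  apply: eq_bigr => i _; transitivity ((P (msrc i) (mtgt i))%:R * mmul T T' i i).
    by rewrite TT' /midm eqxx mulr1.
  rewrite /mmul mulr_sumr; apply: eq_bigr => j _.
  by have [->|/gr[-> ->] //] := eqVneq (T i j) 0; rewrite mul0r !mulr0.
rewrite exchange_big; apply: eq_bigr => j _; rewrite -mulr_sumr.
transitivity ((P (msrc j) (mtgt j))%:R * mmul T' T j j).
  by congr (_ * _); apply: eq_bigr => i _; rewrite mulrC.
by rewrite T'T /midm eqxx mulr1.
Qed.

Definition bij_graded F := bijective (@msrc _ _ _ F) /\ bijective (@mtgt _ _ _ F).


Lemma iso_bij_graded F F' : [pchar k] =i pred0 -> isomorphic F F' ->
  bij_graded F' -> bij_graded F.
Proof.
move=> char0 iso [bs bt]; split; apply/card1_bij => y.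
  rewrite (iso_card_deg (fun x _ => x == y) char0 iso).
  exact: (card1_bij _).2 bs y.
rewrite (iso_card_deg (fun _ z => z == y) char0 iso).
exact: (card1_bij _).2 bt y.
Qed.

Lemma unitF_bij : bij_graded (unitF k u).
Proof. by split; exists id. Qed.

(** The sources of F' exhaust K, so each basis element of F extends to a pair of [comp F F']. Two
    elements with one source would give two pairs with one source, whereas the unit has only one. *)
Lemma invertible_src F : [pchar k] =i pred0 -> invertible u mu F ->
  injective (@msrc _ _ _ F) /\ forall x, exists i : mfB F, msrc i = x.
Proof.
move=> char0 [F' [_ iso iso']].
have [[s sK Ks] _] := iso_bij_graded char0 iso unitF_bij.
have [[s' sK' Ks'] _] := iso_bij_graded char0 iso' unitF_bij.
split=> [i1 i2 e|x]; last by exists (val (s x)).1; apply: Ks.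
have ex (i : mfB F) : exists j : mfB F', mtgt i == msrc j.
  by exists (val (s' (mtgt i))).1; rewrite eq_sym; apply/eqP/Ks'.
have [j1 e1] := ex i1; have [j2 e2] := ex i2.
pose p1 : mfB (Defs.comp F F') := exist _ (i1, j1) e1.
pose p2 : mfB (Defs.comp F F') := exist _ (i2, j2) e2.
by have /(congr1 (fun p => (val p).1)) : p1 = p2 by apply: (can_inj sK).
Qed.

Lemma modfun_col_neq0 F g j : is_modfun F ->
  exists2 i, @mS _ _ _ F g i j != 0 & msrc i = act (msrc j) g /\ mtgt i = act (mtgt j) g.
Proof.
case=> gr _ /(_ g)[T [_ /(_ j j) +]] _; rewrite /midm eqxx => TS.
have /vmul_neq0[i [_ nz]] : vmul (T j) (mS g) j != 0 by rewrite [vmul _ _ _]TS oner_eq0.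
by exists i => //; apply: gr.
Qed.

Lemma modfun_row_neq0 F g i : is_modfun F ->
  exists2 j, @mS _ _ _ F g i j != 0 & msrc i = act (msrc j) g /\ mtgt i = act (mtgt j) g.
Proof.
case=> gr _ /(_ g)[T [/(_ i i) + _]] _; rewrite /midm eqxx => ST.
have [j nz] : exists j, mS g i j != 0.
  apply: NNPP => no; case/eqP: (oner_neq0 k); rewrite -[1]ST /mmul big1 // => j _.
  have [->|nz] := eqVneq (mS g i j) 0; first by rewrite mul0r.
  by case: no; exists j.
by exists j => //; apply: gr.
Qed.

(** Invertibility leaves no zero column, and injectivity of the source allows one row per column:
    [mS g] is monomial. *)
Lemma bij_mS F g i j : is_modfun F -> bij_graded F ->
  (@mS _ _ _ F g i j != 0) = (msrc i == act (msrc j) g).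
Proof.
move=> modF [[s sK _] _]; have [gr _ _] := (modfunP F).1 modF.
apply/idP/eqP => [/gr[] //|e]; have [i' nz [e' _]] := modfun_col_neq0 g j modF.
by rewrite (can_inj sK (etrans e (esym e'))).
Qed.

(** For [bij_graded] F the matrices [mS g] are monomial, so they may be inverted entrywise, with 0
    inverting to 0; exchanging source and target inverts [lam]. *)
Definition invF F : mfun :=
  @MFun _ H k (mfB F) (@mtgt _ _ _ F) (@msrc _ _ _ F) (fun g i j => (mS g i j)^-1).

Lemma invF_modfun F : is_modfun F -> bij_graded F -> is_modfun (invF F).
Proof.
move=> modF bF; have [gr S1 coh] := (modfunP F).1 modF.
apply: (modfunP (invF F)).2; split.
- by move=> g i j /=; rewrite invr_eq0 => /gr[].
- apply: funext2 => i j.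
  by rewrite /= S1 /midm; case: eqP; rewrite ?invr1 ?invr0.
- move=> g1 g2 i j /=; have [[s sK Ks] _] := bF.
  pose m := s (act (@msrc _ _ _ F j) g1).
  have Hm n : @mS _ _ _ F g1 n j != 0 -> n = m.
    by rewrite (@bij_mS F) // => /eqP e; apply: (can_inj sK); rewrite e Ks.
  rewrite [LHS](@vmul_unique _ _ _ _ (@mS _ _ _ (invF F) g1) m) /=; last first.
    by move=> n _ /=; rewrite invr_eq0; apply: Hm.
  have := coh g1 g2 i j.
  rewrite [X in X = _ -> _](@vmul_unique _ _ _ _ (@mS _ _ _ F g1) m); last first.
    by move=> n _; apply: Hm.
  move/(congr1 GRing.inv); rewrite invfM [X in _ = X -> _]invfM => ->.
  by rewrite /lam invf_div.
Qed.

Lemma invF_K F : invF (invF F) = F.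
Proof.
case: F => B s t S; rewrite /invF /=; congr MFun.
apply: funext2 => g i.
by apply: functional_extensionality => j; rewrite invrK.
Qed.

(** Targets are injective, so composable pairs are diagonal and indexed by their source; there each
    entry meets its own inverse. *)
Lemma comp_invF F : is_modfun F -> bij_graded F ->
  isomorphic (Defs.comp F (invF F)) (unitF k u).
Proof.
move=> modF bF; have [[s sK Ks] [t tK Kt]] := bF.
have diag (p : mfB (Defs.comp F (invF F))) : (val p).1 = (val p).2.
  by apply: (can_inj tK); apply/eqP; case: p.
have e x : mtgt (s x, s x).1 == @msrc _ _ _ (invF F) (s x, s x).2 by [].
pose d x : mfB (Defs.comp F (invF F)) := exist _ (s x, s x) (e x).
have dK p : d (msrc (val p).1) = p.
  apply: val_inj; rewrite /= sK; case: p (diag p) => [[i j] /= ?] ->.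
  by [].
pose T (p : mfB (Defs.comp F (invF F))) (x : mfB (unitF k u)) : k :=
  (msrc (val p).1 == x)%:R.
pose T' (x : mfB (unitF k u)) p : k := T p x.
have TT' : mmul T T' = @midm k _.
  apply: funext2 => p q.
  rewrite /mmul /T' /T /midm (bigD1 (msrc (val p).1)) //= eqxx mul1r big1 ?addr0.
    congr (_ %:R); rewrite eq_sym; congr nat_of_bool; apply/eqP/eqP => [eq|->] //.
    by rewrite -(dK p) -(dK q) eq.
  by move=> x; rewrite eq_sym => /negPf->; rewrite mul0r.
have T'T : mmul T' T = @midm k _.
  apply: funext2 => x y.
  rewrite /mmul /T' /T /midm (bigD1 (d x)) //= Ks eqxx mul1r big1 ?addr0 //.
  move=> p; case: (msrc (val p).1 =P x) => [<-|_]; last by rewrite mul0r.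
  by rewrite dK eqxx.
have homT : @is_hom _ _ _ (Defs.comp F (invF F)) (unitF k u) T.
  apply/homP; split=> [p x|g].
    rewrite /T; case: (_ =P x) => [<- _|]; last by rewrite eqxx.
    by split=> //=; rewrite -diag.
  apply: funext2 => p x.
  transitivity ((msrc (val p).1 == act x g)%:R : k).
    rewrite /mmul (bigD1 (d x)) //= /T /= Ks eqxx mulr1 big1 ?addr0; last first.
      move=> q; case: (msrc (val q).1 =P x) => [<-|_]; last by rewrite mulr0.
      by rewrite dK eqxx.
    rewrite -diag -[x in RHS]Ks -(bij_mS g _ _ modF bF).
    by have [->|nz] := eqVneq; rewrite ?mul0r ?divff.
  rewrite /mmul /= (bigD1 (act x g)) //= eqxx mulr1 big1 ?addr0 //.
  by move=> y /negPf->; rewrite mulr0.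
exists T; split=> //; exists T'; split=> [|p q|x y]; rewrite ?TT' ?T'T //.
exact: hom_inv TT' T'T.
Qed.

Lemma bij_invertible F : is_modfun F -> bij_graded F -> invertible u mu F.
Proof.
move=> modF bF; have modI := invF_modfun modF bF.
exists (invF F); split=> //; first exact: comp_invF.
rewrite -[F in Defs.comp _ F]invF_K; apply: comp_invF => //.
by case: bF.
Qed.

(** * Consequences of pointedness *)

(** An invertible simple subfunctor has a single basis vector over the coset 1, which H fixes. Each
    [mS h] therefore acts on it by a nonzero scalar, its target is fixed by H, and its image in F is
    the eigenvector w; coherence makes s a twisted character. *)
Lemma pointed_line F : [pchar k] =i pred0 -> pointed u mu ->
  is_modfun F -> ~ is_zero F ->
  exists z (w : mfB F -> k) (s : gT -> k),
    [/\ homog (pc H 1) z w, exists j, w j != 0, s 1%g = 1 &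
        forall h, h \in H -> [/\ act z h = z, s h != 0,
          forall j, vmul w (mS h) j = s h * w j &
          forall h', h' \in H ->
            s h' * s h = lam h h' (pc H 1) z * s (h * h')%g]].
Proof.
move=> char0 ptd modF nzF.
have [F0 [T [sim0 homT injT]]] := exists_simple_sub modF nzF.
have [modF0 _ _] := sim0; have [inj_src ex_src] := invertible_src char0 (ptd _ sim0).
have [gr S1 coh] := (modfunP F0).1 modF0.
have [grT eqT] := (homP T).1 homT.
have [i si] := ex_src (pc H 1).
have onlyi h j : h \in H -> @mS _ _ _ F0 h i j != 0 -> j = i.
  move=> Hh /gr[e _]; apply: inj_src; apply: (@act_inj _ _ u h).
  by rewrite -e si act1_H.
have onlyi' h j : h \in H -> @mS _ _ _ F0 h j i != 0 -> j = i.
  by move=> Hh /gr[e _]; apply: inj_src; rewrite e si act1_H.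
exists (mtgt i), (T i), (fun h => @mS _ _ _ F0 h i i); split.
- by rewrite -si; apply: grT.
- apply: NNPP => no; case/eqP: (oner_neq0 k).
  have <- : midm k i i = 1 by rewrite /midm eqxx.
  apply: injT => j.
  have -> : vmul (midm k i) T j = T i j by rewrite -[in RHS](mul1m T).
  by apply/eqP/negPn/negP => nz; apply: no; exists j.
- by rewrite S1 /midm eqxx.
move=> h Hh; have [j nz [_ tE]] := modfun_row_neq0 h i modF0.
have Ej := onlyi _ _ Hh nz; rewrite Ej in nz tE; split=> // [m|h' Hh'].
  have -> : vmul (T i) (mS h) m = mmul (@mS _ _ _ F0 h) T i m by rewrite eqT.
  by apply: (@vmul_unique _ _ _ (@mS _ _ _ F0 h i)) => n /(onlyi _ _ Hh).
rewrite -[X in lam _ _ X]si -coh; apply/esym.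
by apply: (@vmul_unique _ _ _ (@mS _ _ _ F0 h' i)) => n /(onlyi _ _ Hh').
Qed.

Lemma pointed_coset y : [pchar k] =i pred0 -> pointed u mu ->
  (forall h, h \in H -> act y h = y) /\
  H2_trivial H (psi (fun g1 g2 x => yconj u y mu g1 g2 x / mu g1 g2 x)).
Proof.
move=> char0 ptd.
have nz : ~ is_zero (freeF (pc H 1) y).
  by apply/eqP; rewrite -lt0n; apply/card_gt0P; exists 1%g.
have [z [w [s [hw [a wa] s1 Hs]]]] :=
  pointed_line char0 ptd (freeF_modfun (pc H 1) y) nz.
have [/eqP/= + Ez] := hw _ wa; rewrite act_pc1 => Ha.
(* The source of a is the coset 1 only for a in H; then z = y <| a, and H fixes z. *)
have zE : z = y.
  rewrite -Ez /=; have [+ _ _ _] := Hs _ (groupVr Ha).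
  by rewrite -Ez /= actK => <-.
(* The multiplier of s is the value of mu at 1 over that at y, the inverse of [psi]; hence the
   inverse of s. *)
rewrite zE in Hs; split=> [h /Hs[]//|]; exists (fun h => (s h)^-1); split.
- by move=> h /Hs[]; rewrite invr_eq0.
- by rewrite s1 invr1.
- move=> h1 h2 H1 H2; have [_ n1 _ /(_ _ H2)] := Hs _ H1.
  have [_ n2 _ _] := Hs _ H2; have [_ n12 _ _] := Hs _ (groupM H1 H2).
  rewrite /psi /yconj sec_1 mulg1 sec_pc /lam => E.
  have my := mu_neq0 h1 h2 y; have m1 := mu_neq0 h1 h2 (pc H 1).
  have -> : (s h1)^-1 / s h2 / (s (h1 * h2)%g)^-1 = s (h1 * h2)%g / (s h2 * s h1).
    by field; rewrite n1 n2 n12 oner_eq0.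
  by rewrite E; field; rewrite m1 my n12.
Qed.

Lemma pointed_normal : [pchar k] =i pred0 -> pointed u mu -> (H <| [set: gT])%g.
Proof.
move=> char0 ptd; rewrite /normal subsetT; apply/subsetP => x _.
rewrite inE; apply/subsetP => _ /imsetP[h Hh ->].
have [/(_ h Hh) /eqP + _] := pointed_coset (pc H x^-1) char0 ptd.
by rewrite act_pc eq_pc invgK conjgE mulgA.
Qed.

(* The functor of diagonal degrees induced from a representation of H. *)
Definition repF n (rH : mx_representation k H n) : mfun :=
  @MFun _ H k (K * 'I_n)%type fst fst
    (fun g p q => (p.1 == act q.1 g)%:R * rH (kappa u q.1 g)^-1%g p.2 q.2).

Lemma repF_modfun n (rH : mx_representation k H n) : is_modfun (repF rH).
Proof.
apply: (modfunP (repF rH)).2; split.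
- move=> g p q /=; case: (p.1 =P _) => [->|_] //.
  by rewrite mul0r eqxx.
- apply: funext2 => -[x i] [y j] /=.
  by rewrite kappa1 invg1 repr_mx1 mxE act1 /midm xpair_eqE -natrM mulnb.
(* Diagonal degrees make the multiplier 1; the inverse of [kappa] accounts for the reversed order of
   composition. *)
- move=> g1 g2 [x i] [y j]; rewrite lamxx mul1r /mmul /=.
  rewrite -(pair_bigA _ (fun z m => (x == act z g2)%:R * rH (kappa u z g2)^-1%g i m *
     ((z == act y g1)%:R * rH (kappa u y g1)^-1%g m j))) /=.
  rewrite (bigD1 (act y g1)) //= [X in _ + X]big1 ?addr0; last first.
    by move=> z /negPf->; apply: big1 => m _; rewrite mul0r mulr0.
  rewrite eqxx -actM kappaM (invMg (kappa u y g1)) repr_mxM ?groupV ?kappa_in // mxE mulr_sumr.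
  by apply: eq_bigr => m _; rewrite mul1r mulrA.
Qed.

(** Over the coset 1, [kappa] is the identity on H, so the component of [repF] there is the
    representation itself. The eigenvector spans an invariant line, which irreducibility makes the
    whole space. *)
Lemma pointed_irr_linear n (rH : mx_representation k H n) :
  [pchar k] =i pred0 -> pointed u mu -> mx_irreducible rH -> n = 1%N.
Proof.
move=> char0 ptd /mx_irrP[n_gt0 irrH].
have nz : ~ is_zero (repF rH).
  by apply/eqP; rewrite -lt0n; apply/card_gt0P; exists (pc H 1, Ordinal n_gt0).
have [z [w [s [hw [[x a] wa] s1 Hs]]]] := pointed_line char0 ptd (repF_modfun rH) nz.
have [/= Ex _] := hw _ wa; rewrite {x}Ex in wa.
pose r : 'rV[k]_n := \row_m w (pc H 1, m).
have modr : mxmodule rH r.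
  apply/mxmoduleP => h Hh; have [_ _ E _] := Hs _ (groupVr Hh).
  suff -> : r *m rH h = s h^-1%g *: r by apply: scalemx_sub.
  apply/rowP => j; have := E (pc H 1, j); rewrite !mxE => <-.
  pose f x m := w (x, m) *
    ((x == act (pc H 1) h^-1)%:R * rH (kappa u (pc H 1) h^-1)^-1%g m j).
  transitivity (\sum_x \sum_m f x m); last first.
    by rewrite pair_bigA; apply: eq_bigr => -[].
  rewrite /f.
  rewrite act1_H ?groupV // kappa_pc1 ?groupV // invgK.
  rewrite (bigD1 (pc H 1)) //= [X in _ + X]big1 ?addr0; last first.
    by move=> y /negPf->; apply: big1 => m _; rewrite mul0r mulr0.
  by apply: eq_bigr => m _; rewrite eqxx mul1r mxE.
have r_neq0 : r != 0.
  by apply: contraNneq wa => /rowP/(_ a); rewrite !mxE => ->.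
have : row_full <<r>>%MS.
  by apply: irrH; rewrite ?(eqmx_module _ (genmxE r)) // -mxrank_eq0 genmxE mxrank_eq0.
rewrite /row_full genmxE => /eqP rk; apply/eqP.
by rewrite eqn_leq n_gt0 andbT -[X in (X <= _)%N]rk rank_leq_row.
Qed.

(** The linear irreducibles number the index of the derived subgroup, and the squared degrees sum to
    the order of H. When all degrees are 1 both equal the number of irreducibles, so the derived
    subgroup is trivial. *)
Lemma pointed_abelian : [pchar k] =i pred0 -> pointed u mu -> abelian H.
Proof.
move=> char0 ptd; have k'H : ([pchar k]^'.-group H)%g.
  by apply/pgroupP => p _ _; rewrite inE /= char0.
have splitH := @group_closure_closed_field k gT H.
apply: (socle_exists (regular_repr k H)) => sH.
have deg1 (i : sH) : irr_degree i = 1%N.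
  exact: pointed_irr_linear char0 ptd (socle_irr i).
have := card_linear_irr sH k'H splitH.
have -> : linear_irr sH = setT by apply/setP => i; rewrite !inE deg1 eqxx.
have := sum_irr_degree_pchar sH k'H splitH.
under eq_bigr do rewrite deg1; rewrite sum1_card cardsT => -> cardH.
apply/derG1P/eqP; rewrite trivg_card1.
have /= := Lagrange (der_sub 1 H); rewrite -cardH => E.
by rewrite -(eqn_pmul2r (cardG_gt0 H)) mul1n E.
Qed.

(** * The converse: simple functors under the three conditions *)

Lemma isomorphic_sym F F' : isomorphic F F' -> isomorphic F' F.
Proof.
by case=> T [homT [T' [homT' TT' T'T]]]; exists T'; split=> //; exists T; split.
Qed.

Lemma coherentP F : coherent F <-> forall g h,
  mmul (@mS _ _ _ F h) (mS g) = mmul (mS (g * h)%g) (diagm (lam g h)).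
Proof.
split=> [coh g h|coh g h i j]; last by rewrite coh mmul_diagr mulrC.
apply: funext2 => i j.
by rewrite coh mmul_diagr mulrC.
Qed.

(** Injectivity of T reduces each identity to the one in F; preservation of degrees lets the
    diagonal multiplier pass through T. *)
Lemma sub_modfun F F' (T : mfB F' -> mfB F -> k) : is_modfun F ->
  graded F' -> is_hom T -> injmx T -> is_modfun F'.
Proof.
move=> /modfunP[gr S1 /coherentP coh] gr' /homP[grT eqT] injT.
apply/modfunP; split=> //; first by apply: (injmx_cancel injT); rewrite eqT S1 mmul1 mul1m.
apply/coherentP => g h; apply: (injmx_cancel injT).
rewrite mmulA eqT -mmulA eqT mmulA coh -mmulA -eqT !mmulA; congr mmul.
apply: funext2 => i j.
rewrite mmul_diagr mmul_diagl mulrC.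
by have [->|/grT[-> ->] //] := eqVneq (T i j) 0; rewrite !mulr0.
Qed.

Section Eigenvector.
Variables (F : mfun) (y : K).
Hypothesis modF : is_modfun F.
Hypothesis cHH : abelian H.
Hypothesis fix_y : forall h, h \in H -> act y h = y.
Hypothesis mu_y :
  H2_trivial H (psi (fun g1 g2 x => yconj u y mu g1 g2 x / mu g1 g2 x)).

Local Notation A := [pred i : mfB F | (msrc i == pc H 1) && (mtgt i == y)].

Lemma homog_fix w h : h \in H -> homog (pc H 1) y w ->
  @homog F (pc H 1) y (vmul w (mS h)).
Proof.
move=> Hh hw; have [gr _ _] := (modfunP F).1 modF.
by apply: homog_act => //; rewrite act1_H // fix_y.
Qed.

Lemma sum_deg (f : mfB F -> k) : (forall i, f i != 0 -> i \in A) ->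
  \sum_i f i = \sum_(a < #|A|) f (enum_val a).
Proof.
move=> fA; rewrite -big_enum_val [RHS]big_mkcond; apply: eq_bigr => i _.
by case: ifPn => // /negP ni; apply/eqP/negPn/negP => /fA.
Qed.

(** Rescaling by the trivialising cochain [al] turns the twisted action of H in degree (1, y) into a
    genuine representation, whose simple submodules are lines because H is abelian and k is
    algebraically closed. *)
Lemma eigenvector (j0 : mfB F) : msrc j0 = pc H 1 -> mtgt j0 = y ->
  exists w, [/\ @homog F (pc H 1) y w, exists j, w j != 0 &
    forall h, h \in H -> exists c, forall j, vmul w (mS h) j = c * w j].
Proof.
move=> sj0 tj0; have [gr S1 coh] := (modfunP F).1 modF.
have [al [al_neq0 al1 al_mu]] := mu_y.
have lamE h1 h2 : h1 \in H -> h2 \in H ->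
    lam h1 h2 (pc H 1) y * (al h1 * al h2) = al (h1 * h2)%g.
  move=> H1 H2; have := al_mu _ _ H1 H2.
  rewrite /psi /yconj sec_1 mulg1 sec_pc => /(canRL (mulfVK (mu_neq0 _ _ _))).
  have n12 := al_neq0 _ (groupM H1 H2).
  have n1 := al_neq0 _ H1; have n2 := al_neq0 _ H2.
  have m1 := mu_neq0 h1 h2 (pc H 1).
  by rewrite /lam => ->; field; rewrite m1 n12 n1 n2.
have AP (a : 'I_#|A|) : msrc (enum_val a) = pc H 1 /\ mtgt (enum_val a) = y.
  by have /andP[/eqP ? /eqP] := enum_valP a.
pose r h : 'M[k]_#|A| :=
  \matrix_(a, b) (al h * @mS _ _ _ F h (enum_val a) (enum_val b)).
have r_repr : mx_repr H r.
  split=> [|g h Hg Hh].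
    apply/matrixP => a b; rewrite !mxE al1 mul1r S1 /midm.
    by rewrite (inj_eq enum_val_inj).
  (* The constraints compose in reverse order; commutativity of H still makes [r] a homomorphism. *)
  rewrite (centsP cHH _ Hg _ Hh); apply/matrixP => a b; rewrite !mxE.
  have := coh h g (enum_val a) (enum_val b); rewrite (AP b).1 (AP b).2 => E.
  rewrite -(lamE h g) // mulrAC -E mulrC /mmul sum_deg.
    by rewrite mulr_sumr; apply: eq_bigr => m _; rewrite !mxE; ring.
  move=> i; rewrite mulf_eq0 negb_or => /andP[/gr[e1 e2] _]; rewrite inE.
  have [sa ta] := AP a; apply/andP; split; apply/eqP.
    by apply: (@act_inj _ _ u g); rewrite -e1 sa act1_H.
  by apply: (@act_inj _ _ u g); rewrite -e2 ta fix_y.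
pose rH := MxRepresentation r_repr.
have A_gt0 : (0 < #|A|)%N.
  by apply/card_gt0P; exists j0; rewrite inE sj0 tj0 !eqxx.
have [V simV _] : {V | mxsimple rH V & (V <= 1%:M)%MS}.
  apply: dec_mxsimple_exists (mxmodule1 _) _.
  by rewrite -mxrank_eq0 mxrank1 -lt0n.
have rkV := mxsimple_abelian_linear (@group_closure_closed_field k gT H) cHH simV.
have [modV V_neq0 _] := simV.
pose v := nz_row V; have v_neq0 : v != 0 by rewrite nz_row_eq0.
have sVv : (V <= v)%MS.
  by rewrite -(geq_leqif (mxrank_leqif_sup (nz_row_sub V))) rkV rank_rV v_neq0.
pose w i := \sum_(a < #|A|) v 0 a * (enum_val a == i)%:R.
have wE (a : 'I_#|A|) : w (enum_val a) = v 0 a.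
  rewrite /w (bigD1 a) //= eqxx mulr1 big1 ?addr0 // => b /negPf ne.
  by rewrite (inj_eq enum_val_inj) ne mulr0.
have hw : homog (pc H 1) y w.
  move=> i wi; apply: NNPP => ni; case/eqP: wi; apply: big1 => a _.
  by case: eqP => [Ei|_]; rewrite ?mulr0 //; case: ni; rewrite -Ei.
exists w; split=> // [|h Hh].
  apply: NNPP => no; case/eqP: v_neq0; apply/rowP => a; rewrite mxE -wE.
  by apply/eqP/negPn/negP => nz; apply: no; exists (enum_val a).
have /sub_rVP[c vc] : (v *m r h <= v)%MS.
  apply: submx_trans sVv; apply: submx_trans (mxmoduleP modV h Hh).
  by rewrite submxMr // nz_row_sub.
exists (c / al h) => j.
have [Aj|nAj] := boolP (j \in A); last first.
  transitivity (0 : k).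
    apply/eqP/negPn/negP => /(homog_fix Hh hw)[sj tj].
    by rewrite inE sj tj !eqxx in nAj.
  apply/esym/eqP; rewrite mulf_eq0; apply/orP; right.
  by apply/negPn/negP => /hw[sj tj]; rewrite inE sj tj !eqxx in nAj.
rewrite -(enum_rankK_in Aj Aj); set b := enum_rank_in Aj j.
rewrite wE mulrAC; have /rowP/(_ b) := vc; rewrite !mxE => <-.
apply: (mulIf (al_neq0 _ Hh)); rewrite divfK ?al_neq0 //.
rewrite /vmul sum_deg ?mulr_suml.
  by apply: eq_bigr => a _; rewrite wE mxE; ring.
move=> i; rewrite mulf_eq0 negb_or => /andP[/hw[si ti] _].
by rewrite inE si ti !eqxx.
Qed.

End Eigenvector.

(** For normal H this is left translation by y in the quotient group. *)
Lemma shift_inj y : (H <| [set: gT])%g -> injective (fun x => act y (u x)).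
Proof.
move=> nsH x x' /eqP; rewrite -[y](sec_pc u) !act_pc eq_pc => yx.
rewrite -(sec_pc u x) -(sec_pc u x'); apply/eqP; rewrite eq_pc.
have nH : u y \in ('N(H))%g by rewrite (subsetP (normal_norm nsH)) ?inE.
rewrite -(memJ_norm _ (groupVr nH)) conjgE invgK.
by move: yx; rewrite invMg !mulgA.
Qed.

(* An H-eigenvector of degree (1, y) generates a submodule functor with basis K,
   the basis vector at x having degree (x, y <| u(x)). *)
Lemma eigenvector_sub F y (w : mfB F -> k) :
  is_modfun F -> (forall h, h \in H -> act y h = y) ->
  homog (pc H 1) y w -> (exists j, w j != 0) ->
  (forall h, h \in H -> exists c, forall j, vmul w (mS h) j = c * w j) ->
  exists S (T : mfB (@MFun _ H k K id (fun x => act y (u x)) S) -> mfB F -> k),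
    [/\ is_modfun (MFun id (fun x => act y (u x)) S), is_hom T & injmx T].
Proof.
move=> modF fix_y hw [j0 wj0] eig; have [gr S1 coh] := (modfunP F).1 modF.
(* Transport of w along (u x)^-1, from degree (1, y) to the degree over x. *)
pose v x : mfB F -> k := vmul w (mS (u x)^-1%g).
have hv x : homog x (act y (u x)) (v x).
  by apply: homog_act => //; rewrite act_secV actK.
have v_neq0 x : exists i, v x i != 0.
  apply: NNPP => no; case/eqP: wj0.
  (* Acting back by u(x) recovers a nonzero multiple of w. *)
  have := coherentV (g1 := u x) (g2 := (u x)^-1%g) (x := pc H 1) (z := y) coh.
  rewrite mulgV !act1 => /(_ w hw gr j0); rewrite S1 vmul1 => /esym/eqP.
  rewrite [X in _ == X]big1 => [|i _]; last first.
    have -> : vmul w (mS (u x)^-1%g) i = 0; last by rewrite mul0r.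
    by apply/eqP/negPn/negP => nz; apply: no; exists i.
  by rewrite mulf_eq0 (negPf (lam_neq0 _ _ _ _)) => /eqP.
have stable g x : exists c, forall j, vmul (v (act x g)) (mS g) j = c * v x j.
  (* Up to multipliers, transporting to x <| g and then applying g is acting first by [kappa u x g],
     where w is an eigenvector, and then by (u x)^-1. *)
  have Ek : (g * (u (act x g))^-1 = (u x)^-1 * kappa u x g)%g.
    by rewrite /kappa -!mulgA mulKg.
  have deg : homog (act x (g * (u (act x g))^-1)%g)
                   (act (act y (u x)) (g * (u (act x g))^-1)%g) w.
    by rewrite -actM act_secV actM Ek mulKVg fix_y ?kappa_in.
  have [c0 Hc0] := eig _ (kappa_in u x g).
  have degk := deg; rewrite Ek in degk.
  exists (lam g (u (act x g))^-1%g x (act y (u x)) *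
    (lam (u x)^-1%g (kappa u x g) x (act y (u x)))^-1 * c0) => j.
  rewrite /v (coherentV coh deg gr) Ek.
  have -> : vmul w (mS ((u x)^-1 * kappa u x g)%g) j =
      (lam (u x)^-1%g (kappa u x g) x (act y (u x)))^-1 *
      (c0 * vmul w (mS (u x)^-1%g) j).
    apply: (mulfI (lam_neq0 (u x)^-1%g (kappa u x g) x (act y (u x)))).
    rewrite mulVKf ?lam_neq0 // -(coherentV coh degk gr) /vmul mulr_sumr.
    by apply: eq_bigr => i _; rewrite [X in X * _ = _]Hc0 mulrA.
  by ring.
(* Reading the scalar at an index where [v x] is nonzero makes it a function of g and x. *)
pose i0 x := xchoose (v_neq0 x); have vi0 x : v x (i0 x) != 0 := xchooseP (v_neq0 x).
pose c g x := vmul (v (act x g)) (mS g) (i0 x) / v x (i0 x).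
have cP g x j : vmul (v (act x g)) (mS g) j = c g x * v x j.
  by have [d Hd] := stable g x; rewrite /c !Hd mulfK.
pose S g x' x : k := (x' == act x g)%:R * c g x.
pose F' : mfun := @MFun _ H k K id (fun x => act y (u x)) S.
have homT : @is_hom _ _ _ F' F v.
  apply/homP; split=> [x|g]; first exact: hv.
  apply: funext2 => x' j.
  have e : x' = act (act x' g^-1) g by rewrite actKV.
  rewrite [LHS](@vmul_unique _ _ _ _ _ (act x' g^-1)) => [|x nz _]; last first.
    move: nz; rewrite /= /S; case: (x' =P _) => [->|_]; first by rewrite actK.
    by rewrite mul0r eqxx.
  by rewrite /= /S -e eqxx mul1r -cP -e.
(* The rows [v x] are nonzero with pairwise distinct sources, hence independent. *)
have injT : @injmx k K (mfB F) v.
  move=> a va x; have := va (i0 x).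
  rewrite (@vmul_unique _ _ _ _ _ x) => [/eqP|x' _ nz]; last first.
    by rewrite -((hv _ _ nz).1); exact: (hv _ _ (vi0 x)).1.
  by rewrite mulf_eq0 (negPf (vi0 x)) orbF => /eqP.
exists S, v; split=> //; apply: (sub_modfun modF _ homT injT).
move=> g x' x /=; rewrite /S; case: (x' =P _) => [-> _|_]; last by rewrite mul0r eqxx.
(* H fixes y, so [kappa u x g] may be inserted after y, and its product with u(x <| g) is u(x) g. *)
split=> //; rewrite actM -[y in LHS](fix_y _ (kappa_in u x g)) actM.
by rewrite /kappa mulgKV.
Qed.

Lemma abelian_normal_pointed : [pchar k] =i pred0 ->
  abelian H -> (H <| [set: gT])%g ->
  (forall y, H2_trivial H (psi (fun g1 g2 x => yconj u y mu g1 g2 x / mu g1 g2 x))) ->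
  pointed u mu.
Proof.
move=> char0 cHH nsH mu_triv F simF; have [modF nzF maxF] := simF.
apply: bij_invertible => //.
have /card_gt0P[i0 _] : (0 < #|mfB F|)%N by rewrite lt0n; apply/eqP.
(* Transitivity of G on K moves any basis element to one over the coset 1; its target serves as
   y. *)
have [j0 _ [sj _]] := modfun_row_neq0 (u (msrc i0)) i0 modF.
have {sj}sj : msrc j0 = pc H 1.
  by apply: (@act_inj _ _ u (u (msrc i0))); rewrite act_sec -sj.
have fix_y h : h \in H -> act (mtgt j0) h = mtgt j0 by apply: act_normal.
have [w [hw nzw eig]] := eigenvector modF cHH fix_y (mu_triv _) sj erefl.
have [S [T [modF' homT injT]]] := eigenvector_sub modF fix_y hw nzw eig.
have [/eqP|isoT] := maxF _ _ modF' homT (injmx_mono injT).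
  by rewrite -leqn0 leqNgt => /negP[]; apply/card_gt0P; exists (pc H 1).
apply: (iso_bij_graded char0 (isomorphic_sym (ex_intro _ _ isoT))); split.
  by exists id.
exact/injF_bij/shift_inj.
Qed.

Lemma pointedP : [pchar k] =i pred0 ->
  pointed u mu <->
  [/\ abelian H, (H <| [set: gT])%g &
      forall y, H2_trivial H (psi (fun g1 g2 x => yconj u y mu g1 g2 x / mu g1 g2 x))].
Proof.
move=> char0; split=> [ptd|[]]; last exact: abelian_normal_pointed.
split; [exact: pointed_abelian | exact: pointed_normal | move=> y].
by case: (pointed_coset y char0 ptd).
Qed.

End ModuleFunctors.

(** * The case of trivial omega: invariance of the class of mu *)

Section Untwisted.
Variables (k : closedFieldType) (gT : finGroupType) (H : {group gT}) (u : section H).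
Variable mu : gT -> gT -> k.
Hypothesis mu_Z2 : Z2_H H mu.

Lemma phi_normalized : C2_normalized (phi u mu).
Proof.
case: mu_Z2 => mu0 mu1 _; split=> [g h x|g x]; first by rewrite mu0 ?kappa_in.
by rewrite /phi !kappa1; split; [case: (mu1 _ (kappa_in u (act u x 1) g))
                                |case: (mu1 _ (kappa_in u x g))].
Qed.

(** By [kappaM], [kappa] is multiplicative along the action, so [phi] pulls the cocycle identity of
    mu on H back to G. *)
Lemma dC2_phi g1 g2 g3 x : dC2 u (phi u mu) g1 g2 g3 x = 1.
Proof.
case: mu_Z2 => mu0 _ muZ; rewrite /dC2 /phi !kappaM !actM muZ ?kappa_in //.
by rewrite divff // mulf_neq0 //; apply: mu0; rewrite ?kappa_in // groupM ?kappa_in.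
Qed.

Lemma H2_trivial_eq (gamma gamma' : gT -> gT -> k) :
  (forall h1 h2, h1 \in H -> h2 \in H -> gamma h1 h2 = gamma' h1 h2) ->
  H2_trivial H gamma -> H2_trivial H gamma'.
Proof.
move=> e [al [al0 al1 alE]]; exists al; split=> // h1 h2 H1 H2.
by rewrite -e ?alE.
Qed.

(** Elements of a normal H fix every coset, so [kappa] at y restricts on H to conjugation by
    u(y). *)
Lemma psi_phi (y : cosetT H) h1 h2 : (H <| [set: gT])%g -> h1 \in H -> h2 \in H ->
  psi (fun g1 g2 x => yconj u y (phi u mu) g1 g2 x / phi u mu g1 g2 x) h1 h2 =
  mu (u y * h1 * (u y)^-1)%g (u y * h2 * (u y)^-1)%g / mu h1 h2.
Proof.
move=> nsH H1 H2; rewrite /psi /yconj sec_1 mulg1 sec_pc /phi.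
rewrite !(act_normal u _ nsH H1) !kappa_pc1 // /kappa.
by rewrite !(act_normal u y nsH).
Qed.

(** Any g differs from the representative of its coset by an element of H, which conjugates the
    abelian group H trivially; testing the representatives is therefore enough. *)
Lemma G_invariantP : abelian H -> (H <| [set: gT])%g ->
  (forall y : cosetT H, H2_trivial H
    (psi (fun g1 g2 x => yconj u y (phi u mu) g1 g2 x / phi u mu g1 g2 x)))
  <-> G_invariant H mu.
Proof.
move=> cHH nsH; split=> [trivy g|invG y]; last first.
  by apply: H2_trivial_eq (invG (u y)) => h1 h2 H1 H2; rewrite psi_phi.
apply: H2_trivial_eq (trivy (pc H g)) => h1 h2 H1 H2; rewrite psi_phi //.
have Ha : (g * (u (pc H g))^-1 \in H)%g by rewrite -eq_pc sec_pc.
suff conj h : h \in H -> (u (pc H g) * h * (u (pc H g))^-1 = g * h * g^-1)%g.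
  by rewrite !conj.
move=> Hh; have Hh' : (u (pc H g) * h * (u (pc H g))^-1 \in H)%g.
  by rewrite -eq_pc -(act_pc u) sec_pc act_normal.
have := centsP cHH _ Ha _ Hh'; rewrite /commute => /esym/(canRL (mulgK _)) ->.
by rewrite invMg invgK !mulgA !mulgKV.
Qed.
End Untwisted.

Theorem theorem3p4 (k : closedFieldType) (gT : finGroupType) (H : {group gT})
    (u : section H) (omega : gT -> gT -> gT -> k) :
  [pchar k] =i pred0 ->
  Z3_normalized omega ->
  (restr_trivial H omega ->
   forall mu : gT -> gT -> cosetT H -> k,
     C2_normalized mu ->
     (forall g1 g2 g3 x, dC2 u mu g1 g2 g3 x = omega g1 g2 g3) ->
     (pointed u mu <->
      [/\ abelian H, (H <| [set: gT])%g &
          forall y : cosetT H,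
            H2_trivial H (psi (fun g1 g2 x => yconj u y mu g1 g2 x / mu g1 g2 x))]))
  /\
  ((forall g1 g2 g3, omega g1 g2 g3 = 1) ->
   forall mu : gT -> gT -> k,
     Z2_H H mu ->
     (pointed u (phi u mu) <->
      [/\ abelian H, (H <| [set: gT])%g & G_invariant H mu])).
Proof.
move=> char0 _; split=> [_ mu mu_norm d_mu|_ mu mu_Z2]; first exact: pointedP d_mu char0.
(* [phi u mu] is a normalised cochain with coboundary 1, so the general equivalence applies to
   it. *)
have ptdP := pointedP (phi_normalized u mu_Z2) (dC2_phi u mu_Z2) char0.
by split=> [/ptdP|] [cHH nsH]; [|move=> inv; apply/ptdP]; split=> //;
  apply/(G_invariantP u mu cHH nsH).
Qed.
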